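(* The metric $\Upsilon$ restricted to the class of proper monoids with bi-invariant metric is complete. Moreover, $\Upsilon$ restricted to the class of proper groups with bi-invariant metric is also complete.
   Context: A metric monoid (resp. metric group) $(G,\delta)$ is a monoid (resp. group) $G$ with a left invariant metric $\delta$ (that is, $\delta(gh,gk)=\delta(h,k)$ for all $g,h,k\in G$) for which the multiplication is continuous (resp. the multiplication and the inverse function are continuous). It is proper when all its closed balls are compact; ''proper monoid'' and ''proper group'' mean proper metric monoid and proper metric group. The metric $\delta$ is bi-invariant when it is left invariant and also right invariant ($\delta(hg,kg)=\delta(h,k)$ for all $g,h,k$). For $r\ge 0$, $G[r]$ is the closed ball of radius $r$ centered at the identity element of $G$. Let $(G_1,\delta_1)$, $(G_2,\delta_2)$ be metric monoids with identity elements $e_1,e_2$, and let $\varepsilon\ge0$, $r\ge0$. $\mathrm{UIso}_{\varepsilon}((G_1,\delta_1)\to(G_2,\delta_2)\,|\,r)$ is the set of all ordered pairs $(\varsigma_1,\varsigma_2)$ of maps (not assumed continuous or multiplicative) $\varsigma_1:G_1\to G_2$, $\varsigma_2:G_2\to G_1$ such that for all $\{j,k\}=\{1,2\}$: $\varsigma_j(e_j)=e_k$, and for all $g,g'\in G_j[r]$ and $h\in G_k[r]$, $|\delta_k(\varsigma_j(g)\varsigma_j(g'),h)-\delta_j(gg',\varsigma_k(h))|\le\varepsilon$. The Gromov-Hausdorff monoid distance between proper metric monoids is $$\Upsilon((G_1,\delta_1),(G_2,\delta_2))=\min\left\{\tfrac{\sqrt2}{2},\inf\left\{\varepsilon>0:\mathrm{UIso}_\varepsilon\left((G_1,\delta_1)\to(G_2,\delta_2)\,\middle|\,\tfrac1\varepsilon\right)\neq\emptyset\right\}\right\}.$$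 It is a metric up to isometric isomorphism of monoids. Completeness of $\Upsilon$ on a class means that every sequence in the class which is Cauchy for $\Upsilon$ converges for $\Upsilon$ to a member of the class. *)

(* Defs.v *)
From HB Require Import structures.
From mathcomp Require Import all_boot all_order all_algebra.
From mathcomp Require Import all_classical all_reals all_analysis.

Set Implicit Arguments.
Unset Strict Implicit.
Unset Printing Implicit Defensive.

Import Order.TTheory GRing.Theory Num.Theory.
Import numFieldNormedType.Exports.

Local Open Scope classical_set_scope.
Local Open Scope ring_scope.

(* The topology of a metricType is the one induced by mdist (lemma ballEmdist),
   so continuity and compactness below refer to the metric. *)
HB.mixin Record Monoid_isMetricMonoid (R : realType) G
    of Metric R G & Monoid G := {
  mdist_mulgl : forall g h k : G, mdist (g * h)%g (g * k)%g = mdist h k ;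
  mulg_continuous : continuous (fun p : G * G => (p.1 * p.2)%g)
}.

#[short(type="metricMonoidType")]
HB.structure Definition MetricMonoid (R : realType) :=
  {G of Metric R G & Monoid G & Monoid_isMetricMonoid R G}.

HB.mixin Record MetricMonoid_isMetricGroup (R : realType) G
    of MetricMonoid R G & Group G := {
  invg_continuous : continuous (fun g : G => g^-1%g)
}.

#[short(type="metricGroupType")]
HB.structure Definition MetricGroup (R : realType) :=
  {G of MetricMonoid R G & Group G & MetricMonoid_isMetricGroup R G}.

Definition mclosed_ball (R : realType) (T : metricType R) (x : T) (r : R) :
  set T := [set y | mdist x y <= r].

HB.mixin Record Metric_isProper (R : realType) T of Metric R T := {
  compact_mclosed_ball : forall (x : T) (r : R), compact (mclosed_ball x r)
}.

#[short(type="properMonoidType")]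
HB.structure Definition ProperMonoid (R : realType) :=
  {G of MetricMonoid R G & Metric_isProper R G}.

#[short(type="properGroupType")]
HB.structure Definition ProperGroup (R : realType) :=
  {G of MetricGroup R G & Metric_isProper R G}.

Definition bi_invariant (R : realType) (G : metricMonoidType R) : Prop :=
  (forall g h k : G, mdist (g * h)%g (g * k)%g = mdist h k) /\
  (forall g h k : G, mdist (h * g)%g (k * g)%g = mdist h k).

Section uiso.
Context (R : realType).
Implicit Types (G H : metricMonoidType R) (e r : R).

(* The conditions on (s, t) for one of the two values of (j, k). *)
Definition half_uiso e r G H (s : G -> H) (t : H -> G) : Prop :=
  s 1%g = 1%g /\
  forall g g' h, mclosed_ball 1%g r g -> mclosed_ball 1%g r g' ->
    mclosed_ball 1%g r h ->
    `|mdist (s g * s g')%g h - mdist (g * g')%g (t h)| <= e.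

Definition uiso e G H (r : R) : set ((G -> H) * (H -> G)) :=
  [set st | half_uiso e r st.1 st.2 /\ half_uiso e r st.2 st.1].

Definition upsilon_set G H : set R :=
  [set e | 0 < e /\ @uiso e G H e^-1 !=set0].

Definition upsilon G H : R :=
  Num.min (Num.sqrt 2 / 2) (inf (upsilon_set G H)).

Lemma half_uiso_cst1 G H e r : r + r <= e ->
  half_uiso e r (fun=> 1%g : H) (fun=> 1%g : G).
Proof.
move=> re; split=> // g g' h; rewrite /mclosed_ball/= => gr g'r hr.
have m1 : mdist (g * g')%g 1%g <= r + r.
  rewrite metric_sym (le_trans (metric_triangle _ g _))// lerD//.
  by rewrite -[X in mdist X _]mulg1 mdist_mulgl.
rewrite mulg1 ler_norml; have := mdist_ge0 (1%g : H) h.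
have := mdist_ge0 (g * g')%g (1%g : G) => a0 b0; apply/andP; split.
  by rewrite lerBrDr addrC (le_trans _ b0)// subr_le0 (le_trans m1).
rewrite lerBlDr (le_trans hr)// -[leLHS]addr0 lerD// (le_trans _ re)//.
by rewrite lerDl (le_trans b0).
Qed.

(* [inf] of the empty set is 0 by convention in the library; this lemma and the
   next show that the infimum in [upsilon] is never that default value. *)
Lemma upsilon_set_nonempty G H : upsilon_set G H !=set0.
Proof.
exists 2; split=> //; exists (fun=> 1%g, fun=> 1%g).
have h : 2^-1 + 2^-1 <= 2 :> R by rewrite -[X in X + X]mul1r -splitr ler1n.
by split; apply: half_uiso_cst1.
Qed.

Lemma upsilon_set_has_inf G H : has_inf (upsilon_set G H).
Proof.
by split; [exact: upsilon_set_nonempty | exists 0 => e [/ltW]].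
Qed.

End uiso.

(* [d] is only meant to be a metric up to isomorphism. The subclass is written
   [C : T -> Prop] because [set T] is universe-inconsistent when [T] is a type of
   structures. *)
Section completeness.
Context (R : realType) (T : Type) (d : T -> T -> R).

Definition dist_cauchy (u : nat -> T) : Prop :=
  forall e : R, 0 < e ->
    exists N, forall m n, (N <= m)%N -> (N <= n)%N -> d (u m) (u n) < e.

Definition dist_cvg (u : nat -> T) (l : T) : Prop :=
  d (u n) l @[n --> \oo] --> (0 : R).

Definition dist_complete (C : T -> Prop) : Prop :=
  forall u : nat -> T, (forall n, C (u n)) -> dist_cauchy u ->
    exists2 l, C l & dist_cvg u l.

End completeness.

(* Main.v *)
(* The limit of a Cauchy sequence (G_n) is its metric ultraproduct L: the
   bounded sequences g_n in G_n modulo lim_U d_n(g_n, h_n) = 0, for a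
   nonprincipal ultrafilter U on nat. Bi-invariance gives
   d(gh, g'h') <= d(g, g') + d(h, h'), so the product descends to L. If
   (s_n, t_n) is an almost isometry between G_N and G_n for U-almost all n, then
   g |-> [s_n g]_n and [h_n]_n |-> lim_U t_n(h_n), which exists because G_N is
   proper, form an almost isometry between G_N and L. These maps make the balls
   of L totally bounded, and countable saturation makes L complete, so L is
   proper. Inverses are computed componentwise. *)

Require Import Defs.
From HB Require Import structures.
From mathcomp Require Import all_boot all_order all_algebra.
From mathcomp Require Import all_classical all_reals all_analysis.
From mathcomp Require Import lra.

Set Implicit Arguments.
Unset Strict Implicit.
Unset Printing Implicit Defensive.

Import Order.TTheory GRing.Theory Num.Theory.
Import numFieldNormedType.Exports.

Local Open Scope classical_set_scope.
Local Open Scope quotient_scope.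
Local Open Scope ring_scope.

(** * Ultrafilters and metric estimates *)

Lemma ultra_fmap (T X : Type) (F : set_system T) (f : T -> X) :
  UltraFilter F -> UltraFilter (f @ F).
Proof.
move=> FU; split=> [|H HF FH]; first exact: fmap_proper_filter.
apply/seteqP; split=> [A HA|]; last exact: FH.
have [//|FnA] := in_ultra_setVsetC (f @^-1` A) FU.
have HnA : H (~` A) by apply: FH.
by have [x []] := @filter_ex _ _ HF _ (filterI HA HnA).
Qed.

(** This replaces the extraction of convergent subsequences: along an ultrafilter a map with values
    in a compact set converges outright, because its image filter is again an ultrafilter. *)
Lemma ultra_compact_cvg (T : Type) (X : topologicalType) (F : set_system T)
    (f : T -> X) (A : set X) : UltraFilter F -> compact A ->
  (\forall t \near F, A (f t)) -> exists2 p, A p & f @ F --> p.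
Proof.
move=> FU; rewrite compact_ultra => cA FA.
by have [p [Ap fp]] := cA _ (ultra_fmap f FU) FA; exists p.
Qed.

Lemma ultra_cvg_bounded (R : realType) (T : Type) (F : set_system T)
    (f : T -> R) (M : R) : UltraFilter F ->
  (\forall t \near F, `|f t| <= M) -> cvg (f @ F).
Proof.
move=> FU fM.
have [|p _ fp] := ultra_compact_cvg (f := f) FU (@segment_compact R (- M) M).
  by apply: filterS fM => t; rewrite /= in_itv/= ler_norml.
by apply/cvg_ex; exists p.
Qed.

Section metric_estimates.
Context (R : realType).

Lemma cvg_mdist (T : Type) (F : set_system T) {FF : Filter F}
    (X : metricType R) (f : T -> X) (p q : X) :
  f @ F --> p -> mdist (f t) q @[t --> F] --> mdist p q.
Proof.
move=> /metricType_numDomainType.cvgrPdist_lt fp; apply/cvgrPdist_lt => e e0.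
apply: filterS (fp e e0) => t; apply: le_lt_trans.
have := metric_triangle (f t) p q; rewrite (metric_sym (f t) p).
by have := metric_triangle p (f t) q; rewrite ler_norml; lra.
Qed.

Lemma bi_invariant_mulg_le (G : metricMonoidType R) : bi_invariant G ->
  forall g h g' h' : G, mdist (g * h)%g (g' * h')%g <= mdist g g' + mdist h h'.
Proof.
move=> [li ri] g h g' h'; rewrite (le_trans (metric_triangle _ (g' * h)%g _))//.
by rewrite ri li.
Qed.

Lemma mdist1M (H : metricMonoidType R) (g h : H) :
  mdist 1%g (g * h)%g <= mdist 1%g g + mdist 1%g h.
Proof.
rewrite (le_trans (metric_triangle _ g _))// lerD2l.
by rewrite -{1}(mulg1 g) mdist_mulgl.
Qed.

End metric_estimates.

(** * The ultraproduct *)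

(** It extends the filter of cofinite sets, so it is nonprincipal. *)
Definition nat_ultra : set_system nat :=
  sval (cid (ultraFilterLemma eventually_filter)).

Instance nat_ultra_ultra : UltraFilter nat_ultra.
Proof. by rewrite /nat_ultra; case: cid => F [] /=. Qed.

Lemma nat_ultra_eventually : eventually `<=` nat_ultra.
Proof. by rewrite /nat_ultra; case: cid => F [] /=. Qed.

Section bounded_sequences.
Context (R : realType) (G : nat -> metricMonoidType R).

Record bseq := BSeq {
  bseq_fun :> forall n, G n ;
  bseq_bounded : exists M : R, forall n, mdist 1%g (bseq_fun n) <= M
}.

(** Forming the quotient requires a choice structure, which is obtained classically. *)
HB.instance Definition _ := gen_eqMixin bseq.
HB.instance Definition _ := gen_choiceMixin bseq.

(** [lim] is total; [ultra_dist_cvg] shows that here it is always a genuine limit, by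
    boundedness. *)
Definition ultra_dist (x y : bseq) : R :=
  lim (mdist (x n) (y n) @[n --> nat_ultra]).

Lemma ultra_dist_cvg (x y : bseq) :
  mdist (x n) (y n) @[n --> nat_ultra] --> ultra_dist x y.
Proof.
have [M xM] := bseq_bounded x; have [N yN] := bseq_bounded y.
apply: (ultra_cvg_bounded (M := M + N)); apply: nearW => n.
rewrite ger0_norm ?mdist_ge0// (le_trans (metric_triangle _ 1%g _))//.
by rewrite metric_sym lerD.
Qed.

Lemma ultra_dist_eq (x y : bseq) (l : R) :
  mdist (x n) (y n) @[n --> nat_ultra] --> l -> ultra_dist x y = l.
Proof. exact: cvg_lim. Qed.

Lemma ultra_distxx x : ultra_dist x x = 0.
Proof.
by apply: ultra_dist_eq; under eq_fun do rewrite mdistxx; exact: cvg_cst.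
Qed.

Lemma ultra_dist_sym x y : ultra_dist x y = ultra_dist y x.
Proof.
apply: ultra_dist_eq; under eq_fun do rewrite metric_sym.
exact: ultra_dist_cvg.
Qed.

Lemma ultra_dist_triangle y x z :
  ultra_dist x z <= ultra_dist x y + ultra_dist y z.
Proof.
have xyz : mdist (x n) (y n) + mdist (y n) (z n) @[n --> nat_ultra] -->
    ultra_dist x y + ultra_dist y z by apply: cvgD; exact: ultra_dist_cvg.
apply: (ler_cvg_to (@ultra_dist_cvg x z) xyz).
by apply: nearW => n; exact: metric_triangle.
Qed.

Lemma ultra_dist_ge0 x y : 0 <= ultra_dist x y.
Proof.
apply: (cvgr_to_ge (@ultra_dist_cvg x y)).
by apply: nearW => n; exact: mdist_ge0.
Qed.

Definition bseq_equiv (x y : bseq) : bool := ultra_dist x y == 0.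

Lemma bseq_equiv_refl : reflexive bseq_equiv.
Proof. by move=> x; rewrite /bseq_equiv ultra_distxx. Qed.

Lemma bseq_equiv_sym : symmetric bseq_equiv.
Proof. by move=> x y; rewrite /bseq_equiv ultra_dist_sym. Qed.

Lemma bseq_equiv_trans : transitive bseq_equiv.
Proof.
move=> y x z /eqP xy /eqP yz; rewrite /bseq_equiv eq_le ultra_dist_ge0 andbT.
by rewrite (le_trans (ultra_dist_triangle y _ _))// xy yz addr0.
Qed.

Canonical bseq_equiv_rel :=
  EquivRel bseq_equiv bseq_equiv_refl bseq_equiv_sym bseq_equiv_trans.

Lemma bseq1_bounded : exists M : R, forall n, mdist 1%g (1%g : G n) <= M.
Proof. by exists 0 => n; rewrite mdistxx. Qed.

Definition bseq1 : bseq := BSeq bseq1_bounded.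

Lemma bseqM_bounded (x y : bseq) :
  exists M : R, forall n, mdist 1%g (x n * y n)%g <= M.
Proof.
have [M xM] := bseq_bounded x; have [N yN] := bseq_bounded y.
by exists (M + N) => n; rewrite (le_trans (mdist1M _ _))// lerD.
Qed.

Definition bseqM (x y : bseq) : bseq := BSeq (bseqM_bounded x y).

Lemma bseq_clip_bounded (M : R) (f : forall n, G n) : exists N : R,
  forall n, mdist 1%g (if mdist 1%g (f n) <= M then f n else 1%g) <= N.
Proof.
(* The absolute value covers a negative [M], for which every term is clipped to the identity. *)
exists (`|M|) => n; case: ifPn => [fM|_]; last by rewrite mdistxx.
by rewrite (le_trans fM)// ler_norm.
Qed.

(** Sequences built below are bounded only for almost all [n]. Replacing far terms by the identity
    makes them bounded everywhere and leaves them unchanged almost everywhere. *)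
Definition bseq_clip (M : R) (f : forall n, G n) : bseq :=
  BSeq (bseq_clip_bounded M f).

Lemma near_bseq_clip (M : R) (f : forall n, G n) :
  (\forall n \near nat_ultra, mdist 1%g (f n) <= M) ->
  \forall n \near nat_ultra, bseq_clip M f n = f n.
Proof. by apply: filterS => n /= ->. Qed.

End bounded_sequences.

Section ultraproduct.
Context (R : realType) (G : nat -> metricMonoidType R).
Hypothesis biG : forall n, bi_invariant (G n).

(* The proofs of bi-invariance are a phantom argument, from which the metric and
   monoid instances on the type are found. *)
Definition ultraprod of (forall n, bi_invariant (G n)) : Type :=
  {eq_quot (@bseq_equiv_rel R G)}.

Local Notation L := (ultraprod biG).

HB.instance Definition _ := Choice.copy L {eq_quot (@bseq_equiv_rel R G)}.

Definition ultra_class (x : bseq G) : L :=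
  \pi_({eq_quot (@bseq_equiv_rel R G)}) x.

Definition ultra_repr (a : L) : bseq G :=
  repr (a : {eq_quot (@bseq_equiv_rel R G)}).

Lemma ultra_reprK a : ultra_class (ultra_repr a) = a.
Proof. exact: reprK. Qed.

Lemma ultra_classP x y : ultra_class x = ultra_class y <-> ultra_dist x y = 0.
Proof.
split=> [|xy]; last by apply/eqmodP/eqP.
by move/eqmodP/eqP.
Qed.

Local Notation cls := ultra_class.

Definition ultra_mdist (a b : L) : R :=
  ultra_dist (ultra_repr a) (ultra_repr b).

Lemma ultra_repr_dist (x : bseq G) : ultra_dist (ultra_repr (cls x)) x = 0.
Proof. by apply/ultra_classP; rewrite ultra_reprK. Qed.

Lemma ultra_dist_compat (x x' y y' : bseq G) :
  ultra_dist x x' = 0 -> ultra_dist y y' = 0 ->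
  ultra_dist x y = ultra_dist x' y'.
Proof.
move=> xx' yy'.
have := ultra_dist_triangle x' x y; have := ultra_dist_triangle y' x' y.
have := ultra_dist_triangle x x' y'; have := ultra_dist_triangle y x y'.
rewrite (ultra_dist_sym x' x) (ultra_dist_sym y' y) xx' yy'.
by move=> *; apply/eqP; rewrite eq_le; lra.
Qed.

Lemma ultra_mdist_class (x y : bseq G) :
  ultra_mdist (cls x) (cls y) = ultra_dist x y.
Proof. by apply: ultra_dist_compat; exact: ultra_repr_dist. Qed.

Lemma ultra_mdistxx a : ultra_mdist a a = 0.
Proof. exact: ultra_distxx. Qed.

Lemma ultra_mdist_positivity a b : ultra_mdist a b = 0 -> a = b.
Proof. by move/ultra_classP; rewrite !ultra_reprK. Qed.

Lemma ultra_mdist_sym a b : ultra_mdist a b = ultra_mdist b a.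
Proof. exact: ultra_dist_sym. Qed.

Lemma ultra_mdist_triangle b a c :
  ultra_mdist a c <= ultra_mdist a b + ultra_mdist b c.
Proof. exact: ultra_dist_triangle. Qed.

HB.instance Definition _ := isMetric.Build R L ultra_mdistxx
  ultra_mdist_positivity ultra_mdist_sym ultra_mdist_triangle.

Lemma mdist_class (x y : bseq G) : mdist (cls x) (cls y) = ultra_dist x y.
Proof. exact: ultra_mdist_class. Qed.

Lemma mdist_class_cvg (x y : bseq G) :
  mdist (x n) (y n) @[n --> nat_ultra] --> mdist (cls x) (cls y).
Proof. by rewrite mdist_class; exact: ultra_dist_cvg. Qed.

(** The transfer principle for equations: the monoid laws, and later the inverse laws, hold in [L]
    because they hold in each [G n]. *)
Lemma ultra_class_near (x y : bseq G) :
  (\forall n \near nat_ultra, x n = y n) -> cls x = cls y.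
Proof.
move=> xy; apply/ultra_classP/ultra_dist_eq.
by apply: cvg_near_cst; apply: filterS xy => n ->; exact: mdistxx.
Qed.

Lemma ultra_class_surj (a : L) : exists x, cls x = a.
Proof. by exists (ultra_repr a); exact: ultra_reprK. Qed.

Definition ultra_one : L := cls (bseq1 G).

Definition ultra_mul (a b : L) : L := cls (bseqM (ultra_repr a) (ultra_repr b)).

Lemma bseqM_dist_le (x y x' y' : bseq G) :
  ultra_dist (bseqM x y) (bseqM x' y') <= ultra_dist x x' + ultra_dist y y'.
Proof.
have D : mdist (x n) (x' n) + mdist (y n) (y' n) @[n --> nat_ultra] -->
    ultra_dist x x' + ultra_dist y y' by apply: cvgD; exact: ultra_dist_cvg.
apply: (ler_cvg_to (@ultra_dist_cvg _ _ _ _) D).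
by apply: nearW => n; exact: bi_invariant_mulg_le.
Qed.

Lemma ultra_mul_class (x y : bseq G) :
  ultra_mul (cls x) (cls y) = cls (bseqM x y).
Proof.
apply/ultra_classP/eqP; rewrite eq_le ultra_dist_ge0 andbT.
by rewrite (le_trans (bseqM_dist_le _ _ _ _))// !ultra_repr_dist addr0.
Qed.

Lemma ultra_mulA : associative ultra_mul.
Proof.
move=> a b c; have [x <-] := ultra_class_surj a.
have [y <-] := ultra_class_surj b; have [z <-] := ultra_class_surj c.
rewrite !ultra_mul_class; apply: ultra_class_near.
by apply: nearW => n; exact: mulgA.
Qed.

Lemma ultra_mul1g : left_id ultra_one ultra_mul.
Proof.
move=> a; have [x <-] := ultra_class_surj a.
rewrite ultra_mul_class; apply: ultra_class_near.
by apply: nearW => n; exact: mul1g.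
Qed.

Lemma ultra_mulg1 : right_id ultra_one ultra_mul.
Proof.
move=> a; have [x <-] := ultra_class_surj a.
rewrite ultra_mul_class; apply: ultra_class_near.
by apply: nearW => n; exact: mulg1.
Qed.

HB.instance Definition _ := isMonoid.Build L ultra_mulA ultra_mul1g ultra_mulg1.

Lemma ultra_class1 : cls (bseq1 G) = 1%g.
Proof. by []. Qed.

Lemma ultra_classM (x y : bseq G) : (cls x * cls y)%g = cls (bseqM x y).
Proof. exact: ultra_mul_class. Qed.

Lemma ultra_mulgl (g h k : L) : mdist (g * h)%g (g * k)%g = mdist h k.
Proof.
have [x <-] := ultra_class_surj g; have [y <-] := ultra_class_surj h.
have [z <-] := ultra_class_surj k.
rewrite !ultra_classM !mdist_class; apply: ultra_dist_eq.
by under eq_fun do rewrite mdist_mulgl; exact: ultra_dist_cvg.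
Qed.

Lemma ultra_mulgr (g h k : L) : mdist (h * g)%g (k * g)%g = mdist h k.
Proof.
have [x <-] := ultra_class_surj g; have [y <-] := ultra_class_surj h.
have [z <-] := ultra_class_surj k.
rewrite !ultra_classM !mdist_class; apply: ultra_dist_eq.
by under eq_fun do rewrite (biG _).2; exact: ultra_dist_cvg.
Qed.

Lemma ultra_mulg_continuous : continuous (fun p : L * L => (p.1 * p.2)%g).
Proof.
move=> [a b]; apply/metricType_numDomainType.cvgrPdist_lt => e e0 /=.
have e20 : 0 < e / 2 by rewrite divr_gt0.
have fa : p.1 @[p --> (a, b)] --> a by exact: cvg_fst.
have fb : p.2 @[p --> (a, b)] --> b by exact: cvg_snd.
near=> p.
(* Passing through [p.1 * b] changes one factor at a time, and each change is measured exactly by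
   one of the two invariances. *)
rewrite (le_lt_trans (metric_triangle _ (p.1 * b)%g _))//.
rewrite ultra_mulgr ultra_mulgl [e]splitr ltrD//; near: p.
  by move/metricType_numDomainType.cvgrPdist_lt : fa; apply.
by move/metricType_numDomainType.cvgrPdist_lt : fb; apply.
Unshelve. all: by end_near. Qed.

HB.instance Definition _ :=
  Monoid_isMetricMonoid.Build R L ultra_mulgl ultra_mulg_continuous.

Lemma ultraprod_bi_invariant : bi_invariant L.
Proof. by split; [exact: ultra_mulgl | exact: ultra_mulgr]. Qed.


End ultraproduct.

(** * Almost isometries *)

Section upsilon_uiso.
Context (R : realType).
Implicit Types (G H : metricMonoidType R) (e : R).

Lemma half_uiso_le G H e1 e2 r1 r2 (s : G -> H) (t : H -> G) :
  e1 <= e2 -> r2 <= r1 -> half_uiso e1 r1 s t -> half_uiso e2 r2 s t.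
Proof.
move=> e12 r21 [s1 st]; split=> // g g' h gr g'r hr.
by rewrite (le_trans _ e12)// st// /mclosed_ball/= (le_trans _ r21).
Qed.

Lemma uiso_le G H e1 e2 r1 r2 : e1 <= e2 -> r2 <= r1 ->
  @uiso R e1 G H r1 `<=` uiso e2 r2.
Proof.
by move=> e12 r21 [s t] [st ts]; split; exact: (half_uiso_le e12 r21).
Qed.

(** This is the case [g' = 1], where [s 1 = 1] removes the second factor; [0 <= r] puts the identity
    in the ball. *)
Lemma half_uiso_approx G H e r (s : G -> H) (t : H -> G) g h :
  0 <= r -> half_uiso e r s t ->
  mdist 1%g g <= r -> mdist 1%g h <= r ->
  `|mdist (s g) h - mdist g (t h)| <= e.
Proof.
move=> r0 [s1 st] gr hr; have := st g 1%g h gr _ hr.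
by rewrite s1 !mulg1; apply; rewrite /mclosed_ball/= mdistxx.
Qed.

Lemma half_uiso_norm_le G H e r (s : G -> H) (t : H -> G) g :
  0 <= r -> half_uiso e r s t -> t 1%g = 1%g ->
  mdist 1%g g <= r -> mdist 1%g (s g) <= mdist 1%g g + e.
Proof.
move=> r0 st t1 gr.
have := half_uiso_approx (h := 1%g) r0 st gr; rewrite mdistxx t1 => /(_ r0).
by rewrite !(metric_sym _ 1%g) ler_norml; lra.
Qed.

Lemma upsilon_ge0 G H : 0 <= upsilon G H.
Proof.
rewrite /upsilon le_min divr_ge0//= lb_le_inf//.
  exact: upsilon_set_nonempty.
by move=> e [/ltW].
Qed.

Lemma upsilon_le G H e : 0 < e -> @uiso R e G H e^-1 !=set0 -> upsilon G H <= e.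
Proof.
move=> e0 ue; rewrite /upsilon ge_min; apply/orP; right.
by apply: ge_inf => //; exact: (upsilon_set_has_inf G H).2.
Qed.

(** Below the cap [sqrt 2 / 2] it is the infimum that is less than [e], so some [f < e] admits an
    almost isometry; enlarging the error and shrinking the radius turns [f] into [e]. *)
Lemma upsilon_lt_uiso G H e : e <= Num.sqrt 2 / 2 -> upsilon G H < e ->
  @uiso R e G H e^-1 !=set0.
Proof.
move=> e2; rewrite /upsilon gt_min ltNge e2/=.
move=> /(inf_lt (upsilon_set_nonempty G H)) [f [f0 [st stf]] fe].
exists st; apply: uiso_le stf; first exact: ltW.
by rewrite lef_pV2 ?posrE ?(lt_trans f0 fe)// ltW.
Qed.

End upsilon_uiso.

Section ultraproduct_uiso.
Context (R : realType) (G : nat -> metricMonoidType R).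
Hypothesis biG : forall n, bi_invariant (G n).

Local Notation L := (ultraprod biG).
Local Notation cls := (ultra_class biG).

Lemma cvg_dist_le (a b : nat -> R) (l m e : R) :
  a @ nat_ultra --> l -> b @ nat_ultra --> m ->
  (\forall n \near nat_ultra, `|a n - b n| <= e) -> `|l - m| <= e.
Proof.
move=> al bm abe.
have ab : `|a n - b n| @[n --> nat_ultra] --> `|l - m|.
  by apply: cvg_norm; apply: cvgB.
exact: cvgr_to_le ab abe.
Qed.

(** The inequalities for the maps at index [n] pass to the ultralimit. The gap [e1 < e2] makes the
    radius drop strictly, so that a class in the ball of radius [r2] has representatives whose terms
    are almost all in the ball of radius [r1]. *)
Lemma ultraprod_uiso (N : nat) (e1 e2 : R) : 0 < e1 -> e1 < e2 ->
  (forall r, compact (mclosed_ball (1%g : G N) r)) ->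
  (\forall n \near nat_ultra, @uiso R e1 (G N) (G n) e1^-1 !=set0) ->
  @uiso R e2 (G N) L e2^-1 !=set0.
Proof.
move=> e10 e12 cG uG.
have e20 : 0 < e2 := lt_trans e10 e12.
set r1 := e1^-1; set r2 := e2^-1.
have r20 : 0 <= r2 by rewrite invr_ge0 ltW.
have r10 : 0 <= r1 by rewrite invr_ge0 ltW.
have r21 : r2 < r1 by rewrite ltf_pV2.
(* The maps are chosen for all [n] at once, with constant maps as default where no almost isometry
   exists. *)
have [st stP] : exists st : forall n, (G N -> G n) * (G n -> G N),
    \forall n \near nat_ultra, uiso e1 r1 (st n).
  have H : forall n, exists p : (G N -> G n) * (G n -> G N),
      @uiso R e1 (G N) (G n) e1^-1 !=set0 -> uiso e1 r1 p.
    move=> n; have [[p up]|nu] := pselect (@uiso R e1 (G N) (G n) e1^-1 !=set0).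
      by exists p.
    by exists (fun=> 1%g, fun=> 1%g).
  exists (fun n => sval (cid (H n))); apply: filterS uG => n.
  exact: svalP (cid (H n)).
(* The almost isometries raise norms by at most [e1], so clipping at [r1 + e1] changes almost no
   term when [g] has norm at most [r2]. *)
pose s (g : G N) : L := cls (bseq_clip (r1 + e1) (fun n => (st n).1 g)).
have near_s g : mdist 1%g g <= r2 -> \forall n \near nat_ultra,
    bseq_clip (r1 + e1) (fun n => (st n).1 g) n = (st n).1 g.
  move=> gr; apply: near_bseq_clip; apply: filterS stP => n [stn tsn].
  rewrite (le_trans (half_uiso_norm_le r10 stn tsn.1 _)) ?lerD2r//.
    by rewrite (le_trans gr)// ltW.
  by rewrite (le_trans gr)// ltW.
have near_ball (x : bseq G) : mdist 1%g (cls x) <= r2 ->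
    \forall n \near nat_ultra, mdist 1%g (x n) <= r1.
  move=> xr; have := @mdist_class_cvg _ _ biG (bseq1 G) x.
  by move/cvgr_le; apply; rewrite (le_lt_trans xr).
(* One representative of each class is fixed together with the limit of its images, so independence
   of the representative is never at issue. The identity is treated apart because it must go exactly
   to the identity; classes outside the ball get the default value [1]. *)
have xtH (h : L) : exists p : bseq G * G N, [/\ cls p.1 = h,
    mdist 1%g h <= r2 -> (st n).2 (p.1 n) @[n --> nat_ultra] --> p.2 &
    h = 1%g -> p.2 = 1%g].
  have [->|h1] := pselect (h = 1%g).
    exists (bseq1 G, 1%g); split=> // _; apply: cvg_near_cst.
    by apply: filterS stP => n [_ []].
  have [hr|hr] := pselect (mdist 1%g h <= r2); last first.
    by exists (ultra_repr h, 1%g); split=> //; exact: ultra_reprK.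
  have [x xh] := ultra_class_surj h; rewrite -xh in hr.
  have [|p _ xp] := @ultra_compact_cvg _ _ _ (fun n => (st n).2 (x n))
      _ nat_ultra_ultra (cG (r1 + e1)).
    have xr := near_ball x hr; near=> n.
    have [stn tsn] : uiso e1 r1 (st n) by near: n.
    have xnr : mdist 1%g (x n) <= r1 by near: n.
    rewrite /mclosed_ball/= (le_trans (half_uiso_norm_le r10 tsn stn.1 _))//.
    by rewrite lerD2r.
  by exists (x, p).
have [xt xtP] := choice xtH.
exists (s, fun h => (xt h).2); split; split => /=.
- rewrite -ultra_class1; apply: ultra_class_near.
  have s1 := near_s 1%g; rewrite mdistxx in s1; near=> n.
  have [[s1n _] _] : uiso e1 r1 (st n) by near: n.
  by rewrite -[RHS]s1n; near: n; exact: s1.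
- move=> g g' h gr g'r hr; rewrite /mclosed_ball/= in gr g'r hr.
  have [xh /(_ hr) th _] := xtP h; rewrite -{1}xh; rewrite -xh in hr.
  rewrite /s ultra_classM (metric_sym (g * g')%g).
  apply: (cvg_dist_le (@mdist_class_cvg _ _ biG _ _) (cvg_mdist th)).
  have sg := near_s g gr; have sg' := near_s g' g'r; have xr := near_ball _ hr.
  near=> n.
  have [[_ stn] _] : uiso e1 r1 (st n) by near: n.
  have -> : bseqM (bseq_clip (r1 + e1) (fun n => (st n).1 g))
           (bseq_clip (r1 + e1) (fun n => (st n).1 g')) n =
      ((st n).1 g * (st n).1 g')%g.
    by congr (_ * _)%g; near: n.
  rewrite (metric_sym _ (g * g')%g).
  apply: le_trans (ltW e12); apply: stn; rewrite /mclosed_ball/=.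
  + by rewrite (le_trans gr)// ltW.
  + by rewrite (le_trans g'r)// ltW.
  + by near: n.
- by have [_ _] := xtP 1%g; exact.
- move=> h h' g hr h'r gr; rewrite /mclosed_ball/= in hr h'r gr.
  have [xh /(_ hr) th _] := xtP h; have [xh' /(_ h'r) th' _] := xtP h'.
  rewrite -{2}xh -{2}xh' /s ultra_classM.
  rewrite -xh in hr; rewrite -xh' in h'r.
  (* Continuity of the product in [G N] makes the products of images converge to the product of the
     limits. *)
  have tt : ((st n).2 ((xt h).1 n) * (st n).2 ((xt h').1 n))%g
      @[n --> nat_ultra] --> ((xt h).2 * (xt h').2)%g.
    have := @mulg_continuous _ (G N) ((xt h).2, (xt h').2).
    exact: cvg_comp (cvg_pair th th').
  apply: (cvg_dist_le (cvg_mdist tt) (@mdist_class_cvg _ _ biG _ _)).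
  have sg := near_s g gr; have xr := near_ball _ hr.
  have xr' := near_ball _ h'r.
  near=> n.
  have [_ [_ tsn]] : uiso e1 r1 (st n) by near: n.
  have -> : bseq_clip (r1 + e1) (fun n => (st n).1 g) n = (st n).1 g by near: n.
  apply: le_trans (ltW e12); apply: tsn; rewrite /mclosed_ball/=.
  + by near: n.
  + by near: n.
  + by rewrite (le_trans gr)// ltW.
Unshelve. all: by end_near. Qed.

End ultraproduct_uiso.

(** * Completeness and properness of the ultraproduct *)

Lemma near_all_le (F : set_system nat) (P : nat -> nat -> Prop) (m : nat) :
  Filter F -> (forall k, \forall n \near F, P k n) ->
  \forall n \near F, forall k, (k <= m)%N -> P k n.
Proof.
move=> FF FP; elim: m => [|m IHm].
  by apply: filterS (FP 0%N) => n P0 k; rewrite leqn0 => /eqP ->.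
apply: filterS2 IHm (FP m.+1) => n Pm Pm1 k.
by rewrite leq_eqVlt => /predU1P[->//|]; exact: Pm.
Qed.

Section ultraproduct_complete.
Context (R : realType) (G : nat -> metricMonoidType R).
Hypothesis biG : forall n, bi_invariant (G n).

Local Notation L := (ultraprod biG).
Local Notation cls := (ultra_class biG).

Lemma ultra_class_near_le (x : bseq G) (f : forall n, G n) (e : R) :
  (\forall n \near nat_ultra, mdist (x n) (f n) <= e) ->
  exists2 z : bseq G, (\forall n \near nat_ultra, z n = f n) &
    mdist (cls x) (cls z) <= e.
Proof.
move=> xf; have [M xM] := bseq_bounded x.
(* The terms of [x] have norm at most [M] and those of [f] are almost all within [e] of them, hence
   the radius [M + e]. *)
have zf : \forall n \near nat_ultra, bseq_clip (M + e) f n = f n.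
  apply: near_bseq_clip; apply: filterS xf => n xfn.
  by rewrite (le_trans (metric_triangle _ (x n) _))// lerD.
exists (bseq_clip (M + e) f) => //.
apply: (cvgr_to_le (@mdist_class_cvg _ _ biG _ _)).
by apply: filterS2 xf zf => n xfn ->.
Qed.

(* Countable saturation: a Cauchy sequence of classes [x k] converges to the
   class of a diagonal sequence [n |-> x (m n) n]. *)
Lemma ultraprod_cauchy_lim (x : nat -> bseq G) :
  (forall k j, mdist (cls (x k)) (cls (x j)) < k.+1%:R^-1 + j.+1%:R^-1) ->
  exists z, forall k, mdist (cls (x k)) (cls z) <= k.+1%:R^-1 + k.+1%:R^-1.
Proof.
move=> xC.
pose P (k n : nat) := forall j, (j <= k)%N ->
  mdist (x j n) (x k n) <= j.+1%:R^-1 + k.+1%:R^-1.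
have nearP k : \forall n \near nat_ultra, P k n.
  apply: (@near_all_le _ (fun j n =>
    mdist (x j n) (x k n) <= j.+1%:R^-1 + k.+1%:R^-1)) => j.
  have := @mdist_class_cvg _ _ biG (x j) (x k); move/cvgr_le; apply.
  exact: xC.
(* [m n] is the largest [k <= n] with [P k n]. It exists because [P 0 n] always holds, its only
   instance being [j = 0]. *)
have /choice [m mP] n : exists m, P m n /\
    forall k, (k <= n)%N -> P k n -> (k <= m)%N.
  have P0 : exists k, (k <= n)%N && `[< P k n >].
    exists 0%N => /=; apply/asboolP => j; rewrite leqn0 => /eqP ->.
    by rewrite mdistxx addr_ge0.
  have Pn k : (k <= n)%N && `[< P k n >] -> (k <= n)%N by case/andP.
  exists (ex_maxn P0 Pn); case: ex_maxnP => i /andP[_ /asboolP Pi] maxi.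
  by split=> // k kn Pk; apply: maxi; rewrite kn; apply/asboolP.
have near_x k : \forall n \near nat_ultra,
    mdist (x k n) (x (m n) n) <= k.+1%:R^-1 + k.+1%:R^-1.
  (* Here nonprincipality is used: almost every [n] is at least [k], so [k] competes in the maximum
     and [k <= m n]. Then [P (m n) n] at [j = k] gives the bound. *)
  have kn : nat_ultra [set n | (k <= n)%N].
    exact: nat_ultra_eventually (nbhs_infty_ge k).
  apply: filterS2 (nearP k) kn => n Pkn kn; have [Pm /(_ k kn Pkn) km] := mP n.
  by rewrite (le_trans (Pm k km))// lerD2l lef_pV2 ?posrE// ler_nat.
(* The case [k = 0] provides a bounded [z] equal to the diagonal almost everywhere. The [z'] found
   for another [k] has the same property, hence the same class. *)
have [z zx _] := ultra_class_near_le (near_x 0%N).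
exists z => k; have [z' z'x] := ultra_class_near_le (near_x k).
rewrite (@ultra_class_near _ _ biG z' z)//.
by apply: filterS2 zx z'x => n -> ->.
Qed.

Lemma ultraprod_complete (F : set_system L) : ProperFilter F ->
  (forall e, 0 < e -> exists a : L, \forall y \near F, mdist a y < e) ->
  exists a : L, F --> a.
Proof.
move=> PF FC.
have /choice [a aF] (k : nat) : exists a : L,
    \forall y \near F, mdist a y < k.+1%:R^-1 by apply: FC; rewrite invr_gt0.
have /choice [x xa] (k : nat) := ultra_class_surj (a k).
have [|z xz] := @ultraprod_cauchy_lim x.
  move=> k j; have [y [ky jy]] := filter_ex (filterI (aF k) (aF j)).
  rewrite !xa (le_lt_trans (metric_triangle _ y _))// ltrD//.
  by rewrite metric_sym.
exists (cls z); apply/metricType_numDomainType.fcvgrPdist_lt => e e0.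
(* Two thirds bound the distance from [cls z] to [a k], the last third that from [a k] to [y]. *)
have e30 : 0 < e / 3 by rewrite divr_gt0.
have [k _ /(_ k (leqnn _)) ke] := near_infty_natSinv_lt (PosNum e30).
apply: filterS (aF k) => y aky; have := xz k; rewrite xa => akz.
rewrite (le_lt_trans (metric_triangle _ (a k) _))// (metric_sym (cls z)).
by rewrite /= in ke; move: ke akz aky; set i := k.+1%:R^-1; lra.
Qed.

(** By completeness it suffices that an ultrafilter on a ball is Cauchy. Its image under [t] lies in
    a compact ball of [G N] and converges there; since [s] and [t] nearly preserve distances, points
    with close images are close in [L]. *)
Lemma ultraprod_proper :
  (forall e : R, 0 < e -> exists f N, [/\ 0 < f, f < e,
    forall r, compact (mclosed_ball (1%g : G N) r) &
    @uiso R f (G N) L f^-1 !=set0]) ->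
  forall (a : L) (r : R), compact (mclosed_ball a r).
Proof.
move=> GL a r; rewrite compact_ultra => F FU Far.
suff [l Fl] : exists l : L, F --> l.
  exists l; split=> //; rewrite /mclosed_ball/= metric_sym.
  have la : mdist y a @[y --> F] --> mdist l a by exact: cvg_mdist Fl.
  apply: (cvgr_to_le la).
  by apply: filterS Far => y; rewrite /mclosed_ball/= metric_sym.
apply: ultraprod_complete => e e0.
pose M := `|r| + mdist 1%g a.
have M0 : 0 <= M by rewrite addr_ge0 ?mdist_ge0.
have FM : \forall y \near F, mdist 1%g y <= M.
  apply: filterS Far => y /= ar; rewrite (le_trans (metric_triangle _ a _))//.
  by rewrite addrC lerD2r (le_trans ar)// ler_norm.
(* The distance from [h0] to [h] will cost four errors [f]: one from [h0] to [s (t h0)], one for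
   comparing through [s], and two from [t h0] to [t h] through [p]. The other bound gives
   [M + 2 <= f^-1], so that both points of norm at most [M] and their images, of norm at most
   [M + f], stay in the ball. *)
have [|f [N [f0 fe cN [[s t] [st ts]]]]] := GL (Num.min (e / 4) (M + 2)^-1).
  by rewrite lt_min divr_gt0//= invr_gt0 ltr_wpDl.
move: fe; rewrite lt_min => /andP[fe fM]; rewrite /= in st ts.
have f1 : f <= 1.
  rewrite (le_trans (ltW fM))// invf_le1; first by lra.
  by rewrite ltr_wpDl.
have Mf : M + 2 <= f^-1.
  by rewrite -[leLHS]invrK lef_pV2 ?posrE ?invr_gt0 ?ltr_wpDl// ltW.
have fi0 : 0 <= f^-1 by rewrite invr_ge0 ltW.
have tM h : mdist 1%g h <= M -> mdist 1%g (t h) <= f^-1.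
  move=> hM; rewrite (le_trans (half_uiso_norm_le fi0 ts st.1 _))//; lra.
have [|p pM tp] := @ultra_compact_cvg _ _ _ t _ FU (cN f^-1).
  by apply: filterS FM => h; exact: tM.
have Fp : \forall y \near F, mdist p (t y) < f.
  by move/metricType_numDomainType.cvgrPdist_lt : tp; exact.
have [h0 [h0M h0p]] := filter_ex (filterI FM Fp).
exists h0; apply: filterS2 FM Fp => h hM hp.
have hf : mdist 1%g h <= f^-1 by lra.
have h0f : mdist 1%g h0 <= f^-1 by rewrite /= in h0M; lra.
have A := half_uiso_approx fi0 ts h0f (tM _ h0M).
have B := half_uiso_approx fi0 st (tM _ h0M) hf.
rewrite mdistxx sub0r normrN in A.
rewrite (ger0_norm (mdist_ge0 _ _)) in A.
have C := metric_triangle (t h0) p (t h); rewrite (metric_sym (t h0) p) in C.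
have D := metric_triangle h0 (s (t h0)) h.
move: B; rewrite ler_norml /= in h0p * => /andP[_ B].
lra.
Qed.

End ultraproduct_complete.

(** * Limits of Cauchy sequences *)

Section group_of_monoid.
Context (R : realType) (M : properMonoidType R) (i : M -> M).
Hypotheses (mulVi : left_inverse 1%g i *%g) (muliV : right_inverse 1%g i *%g).
Hypothesis i_continuous : continuous i.

(** A copy of the type [M] whose phantom arguments carry the inverse laws and continuity, from which
    the group instances are found. *)
Definition group_of_monoid of left_inverse 1%g i *%g &
  right_inverse 1%g i *%g & continuous i : Type := M.

Local Notation H := (group_of_monoid mulVi muliV i_continuous).

HB.instance Definition _ := ProperMonoid.copy H M.
HB.instance Definition _ := hasInv.Build H i.
HB.instance Definition _ := Monoid_isGroup.Build H mulVi muliV.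
HB.instance Definition _ :=
  MetricMonoid_isMetricGroup.Build R H i_continuous.

End group_of_monoid.

(** An equality of whole structures, not just an isomorphism, so bi-invariance and convergence
    transport by rewriting. *)
Lemma group_of_monoidE (R : realType) (M : properMonoidType R) (i : M -> M)
    (Vi : left_inverse 1%g i *%g) (iV : right_inverse 1%g i *%g)
    (ic : continuous i) :
  (group_of_monoid Vi iV ic : properGroupType R) = M :> properMonoidType R.
Proof. by case: M i Vi iV ic => T []. Qed.

Lemma bi_invariant_properGroup (R : realType) (M : properMonoidType R) :
  bi_invariant M -> (forall a : M, exists b : M, (b * a = 1 /\ a * b = 1)%g) ->
  exists H : properGroupType R, (H : properMonoidType R) = M.
Proof.
move=> biM /choice [i iP].
have mulVi : left_inverse 1%g i ( *%g : M -> M -> M).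
  by move=> a; exact: (iP a).1.
have muliV : right_inverse 1%g i ( *%g : M -> M -> M).
  by move=> a; exact: (iP a).2.
(* Multiplying by [a] on the left and by [b] on the right turns the pair [i a], [i b] into [b], [a];
   so inversion is an isometry. *)
have i_dist a b : mdist (i a) (i b) = mdist a b.
  by rewrite -(biM.1 a) -(biM.2 b) muliV mul1g -mulgA mulVi mulg1 metric_sym.
have i_cont : continuous i.
  move=> a; apply/metricType_numDomainType.cvgrPdist_lt => e e0.
  near=> b; rewrite i_dist; near: b.
  have aa : b @[b --> a] --> a by exact: cvg_id.
  by move/metricType_numDomainType.cvgrPdist_lt : aa; apply.
exists (group_of_monoid mulVi muliV i_cont : properGroupType R).
exact: group_of_monoidE.
Unshelve. all: by end_near. Qed.

Lemma dist_cauchy_upsilon_uiso (R : realType) (T : Type)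
    (G : T -> metricMonoidType R) (u : nat -> T) (e : R) : 0 < e ->
  dist_cauchy (fun x y => upsilon (G x) (G y)) u ->
  exists2 f, 0 < f < e &
    exists N, forall m n, (N <= m)%N -> (N <= n)%N ->
      @uiso R f (G (u m)) (G (u n)) f^-1 !=set0.
Proof.
(* The bound [1 / 2] keeps [f] below the cap [sqrt 2 / 2]. *)
move=> e0 uC; pose f : R := Num.min (e / 2) (1 / 2).
have f0 : 0 < f by rewrite lt_min !divr_gt0.
have fe : f < e by rewrite gt_min; apply/orP; left; lra.
exists f; first by rewrite f0.
have [N uN] := uC f f0; exists N => m n Nm Nn.
apply: upsilon_lt_uiso (uN m n Nm Nn).
rewrite ge_min; apply/orP; right; rewrite ler_pM2r ?invr_gt0//.
by rewrite -[leLHS]sqrtr1 ler_wsqrtr// ler1n.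
Qed.

Section limit.
Context (R : realType) (G : nat -> properMonoidType R).
Hypothesis biG : forall n, bi_invariant (G n).
Hypothesis GC :
  dist_cauchy (fun G H : properMonoidType R => upsilon G H) G.

Local Notation L := (ultraprod biG).

Lemma ultraprod_uiso_near (e : R) : 0 < e -> exists2 f, 0 < f < e &
  exists N, forall m, (N <= m)%N -> @uiso R f (G m) L f^-1 !=set0.
Proof.
move=> e0; have e20 : 0 < e / 2 by rewrite divr_gt0.
have [f /andP[f0 fe] [N fN]] := dist_cauchy_upsilon_uiso e20 GC.
(* The error [f] between terms grows to [e / 2], which provides the gap needed by
   [ultraprod_uiso]. *)
exists (e / 2); first by lra.
exists N => m Nm; apply: (@ultraprod_uiso _ _ biG m _ _ f0 fe).
  by move=> r; exact: compact_mclosed_ball.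
apply: filterS (nat_ultra_eventually (nbhs_infty_ge N)) => n; exact: fN.
Qed.

Lemma ultraprod_closed_ball_compact (a : L) (r : R) :
  compact (mclosed_ball a r).
Proof.
apply: ultraprod_proper => e /ultraprod_uiso_near [f /andP[f0 fe] [N fN]].
exists f, N; split=> //; first by move=> s; exact: compact_mclosed_ball.
exact: fN.
Qed.

Lemma properMonoid_limit : exists H : properMonoidType R,
  [/\ bi_invariant H,
     dist_cvg (fun G H : properMonoidType R => upsilon G H) G H &
     (forall n (a : G n), exists b : G n, (b * a = 1 /\ a * b = 1)%g) ->
     forall a : H, exists b : H, (b * a = 1 /\ a * b = 1)%g].
Proof.
(* Properness depends on the Cauchy hypothesis, so this structure is packed locally. *)
pose P := Metric_isProper.Build R L ultraprod_closed_ball_compact.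
pose H : properMonoidType R := HB.pack L (MetricMonoid.on L) P.
exists H; split; first exact: (ultraprod_bi_invariant biG).
  (* Convergence holds along the whole sequence, not only along the ultrafilter, since every index
     past [N] is almost isometric to [L]. *)
  apply/cvgrPdist_lt => e e0.
  have [f /andP[f0 fe] [N fN]] := ultraprod_uiso_near e0.
  exists N => // m /= Nm; rewrite sub0r normrN ger0_norm ?upsilon_ge0//.
  exact: le_lt_trans (upsilon_le f0 (fN m Nm)) fe.
move=> inv a; have [x xa] := ultra_class_surj (a : L).
pose y n := sval (cid (inv n (x n))).
have yP n : (y n * x n = 1 /\ x n * y n = 1)%g := svalP (cid (inv n (x n))).
(* Left translation by [x n] shows that inverses have the same norm, so they form a bounded
   sequence. *)
have y_dist n : mdist 1%g (y n) = mdist 1%g (x n).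
  by rewrite -(mdist_mulgl (x n)) (yP n).2 mulg1 metric_sym.
have [M xM] := bseq_bounded x.
have yM : exists M, forall n, mdist 1%g (y n) <= M.
  by exists M => n; rewrite y_dist.
exists (ultra_class biG (BSeq yM)); rewrite -xa.
split; rewrite [LHS]ultra_classM -[RHS]ultra_class1; apply: ultra_class_near;
  apply: nearW => n.
  exact: (yP n).1.
exact: (yP n).2.
Qed.

End limit.

Theorem corollary3p7 (R : realType) :
  dist_complete (fun G H : properMonoidType R => upsilon G H)
    (fun G : properMonoidType R => bi_invariant G) /\
  dist_complete (fun G H : properGroupType R => upsilon G H)
    (fun G : properGroupType R => bi_invariant G).
Proof.
split=> u biu uC.
  by have [H [biH uH _]] := properMonoid_limit biu uC; exists H.
(* A Cauchy sequence of groups is first given a limit among monoids, whose elements turn out to be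
   invertible. *)
have [M [biM uM invM]] := @properMonoid_limit R u biu uC.
have [|H HM] := bi_invariant_properGroup biM.
  by apply: invM => n a; exists a^-1%g; rewrite mulVg mulgV.
exists H; first by move: biM; rewrite -HM.
by move: uM; rewrite -HM.
Qed.
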